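(* Let $K\subset\mathbb{R}^n$ be a body, and let $\mathcal{E},\mathcal{F}\subset\mathbb{R}^n$ be ellipsoids such that $\mathcal{F}\subset K$. Then $\mathcal{F}=u_K(\mathcal{E})$ if and only if there exists a non-zero $\mathcal{E}$-isotropic measure $\nu$ supported on $\partial\mathcal{F}\cap\partial K$.
   Context: A body in $\mathbb{R}^n$ is a compact convex set $K$ with $K=-K$ and non-empty interior; $\|x\|_K=\inf\{\lambda>0: x\in\lambda K\}$ is the norm with unit ball $K$. An ellipsoid means a centrally-symmetric (centered at the origin), non-degenerate ellipsoid. For an ellipsoid $\mathcal{E}$, $\langle\cdot,\cdot\rangle_{\mathcal{E}}$ is the unique scalar product on $\mathbb{R}^n$ with $\mathcal{E}=\{x:\langle x,x\rangle_{\mathcal{E}}\le 1\}$, and $\mu_{\mathcal{E}}$ is the unique Borel probability measure on $\partial\mathcal{E}$ invariant under all linear isometries of $(\mathbb{R}^n,\langle\cdot,\cdot\rangle_{\mathcal{E}})$. For a body $K$, $M_{\mathcal{E}}(K)=\left(\int_{\partial\mathcal{E}}\|x\|_K^2\,d\mu_{\mathcal{E}}(x)\right)^{1/2}$. For a body $K$ and an ellipsoid $\mathcal{E}$, $u_K(\mathcal{E})$ denotes the unique ellipsoid contained in $K$ at which the infimum $J_K(\mathcal{E})=\inf\{M_{\mathcal{E}}(\mathcal{F}):\mathcal{F}\subset K\text{ an ellipsoid}\}$ is attained (such an ellipsoid exists and is unique). A finite Borel measure $\nu$ on $\mathbb{R}^n$ is called $\mathcal{E}$-isotropic if there is a constant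 $L_\nu$, independent of $\theta$, such that $\int\langle x,\theta\rangle_{\mathcal{E}}^2\,d\nu(x)=L_\nu^2\langle\theta,\theta\rangle_{\mathcal{E}}$ for every $\theta\in\mathbb{R}^n$. *)

(* Defs.v *)
From HB Require Import structures.
From mathcomp Require Import all_boot all_order all_algebra.
From mathcomp Require Import all_classical all_reals all_analysis.

Set Implicit Arguments.
Unset Strict Implicit.
Unset Printing Implicit Defensive.

Import Order.TTheory GRing.Theory Num.Theory.
Import numFieldNormedType.Exports.

Local Open Scope classical_set_scope.
Local Open Scope ring_scope.

(* R^n is 'rV[R]_n, with its product topology; [borelRV R n] is the same type
   carrying the Borel sigma-algebra. *)
Definition borelRV (R : realType) (n : nat) :=
  g_sigma_algebraType (@open 'rV[R]_n).

Section Bodies.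
Context {R : realType} {n : nat}.
Implicit Types (K E F : set 'rV[R]_n) (x y : 'rV[R]_n).

Definition boundary K : set 'rV[R]_n := closure K `\` interior K.

Definition body K : Prop :=
  [/\ compact K, @convex_set R 'rV[R]_n K, K = [set - x | x in K]
    & interior K !=set0].

Definition body_norm K x : R :=
  inf [set l : R | 0 < l /\ [set l *: y | y in K] x].

Definition scalar_product_ball (p : 'rV[R]_n -> 'rV[R]_n -> R) :
  set 'rV[R]_n := [set x | p x x <= 1].

Definition is_scalar_product_of E (p : 'rV[R]_n -> 'rV[R]_n -> R) : Prop :=
  exists q : {dot 'rV[R]_n for (@idfun R)},
    p = (q : 'rV[R]_n -> 'rV[R]_n -> R) /\ E = scalar_product_ball q.

Definition ellipsoid E : Prop := exists p, is_scalar_product_of E p.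

(* <x, y>_E; a scalar product is determined by its unit ball, so that [get]
   picks the only candidate when E is an ellipsoid. *)
Definition eprod E : 'rV[R]_n -> 'rV[R]_n -> R :=
  get [set p | is_scalar_product_of E p].

(* This characterizes mu_E, seen as a Borel measure on R^n carried by the
   boundary of E. *)
Definition invariant_probability E (mu : probability (borelRV R n) R) : Prop :=
  mu (boundary E) = 1%E /\
  forall T : {linear 'rV[R]_n -> 'rV[R]_n},
    (forall x y, eprod E (T x) (T y) = eprod E x y) ->
    forall A : set (borelRV R n), measurable A -> mu (T @^-1` A) = mu A.

(* In the next three definitions mu stands for mu_E. *)
Definition Mean E (mu : probability (borelRV R n) R) K : R :=
  Num.sqrt (\int[mu]_(x in boundary E) (body_norm K x ^+ 2)).

Definition inf_Mean E (mu : probability (borelRV R n) R) K : R :=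
  inf [set Mean E mu F | F in [set F | ellipsoid F /\ F `<=` K]].

(* F = u_K(E): F is the one and only ellipsoid inside K attaining J_K(E). *)
Definition is_u E (mu : probability (borelRV R n) R) K F : Prop :=
  unique (fun G => [/\ ellipsoid G, G `<=` K & Mean E mu G = inf_Mean E mu K])
    F.

Definition isotropic E (nu : {finite_measure set (borelRV R n) -> \bar R}) :
  Prop :=
  exists L : R, forall theta : 'rV[R]_n,
    (\int[nu]_x (eprod E x theta ^+ 2)%:E =
      (L ^+ 2 * eprod E theta theta)%:E)%E.

Definition supported_on (nu : {finite_measure set (borelRV R n) -> \bar R})
  (A : set 'rV[R]_n) : Prop := nu (~` A) = 0%E.

End Bodies.

(* Main.v *)
(* Write E = {x P x^T <= 1} and F = {x A x^T <= 1}. Invariance under reflections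
   makes mu_E isotropic, so M_E(F)^2 is a positive multiple of tr(A P^-1), and a
   measure nu is E-isotropic exactly when its second moment matrix is a multiple
   of P^-1.

   If an isotropic nu lives on the contact set and G = {x B x^T <= 1} is another
   ellipsoid in K, then every contact point x satisfies
   x A B^-1 A x^T <= 1 = x A x^T, because the tangent hyperplane of F at x
   supports K. Integrating, tr(A B^-1 A P^-1) <= tr(A P^-1), and expanding the
   positive semidefinite matrix (B - A) B^-1 (B - A) gives
   tr(A P^-1) <= tr(B P^-1), with equality only if B = A.

   Conversely, by Caratheodory and a nearest-point argument, either P^-1 is a
   conic combination of the matrices x^T x, x a contact point, which yields a
   discrete isotropic measure, or some symmetric H satisfies x H x^T > 0 at every
   contact point and tr(H P^-1) < 0. In the second case the ellipsoid of
   A + s H, for s > 0 small, stays in K and has a smaller trace. *)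
From HB Require Import structures.
Require Import Defs.
From mathcomp Require Import all_boot all_order all_algebra.
From mathcomp Require Import all_classical all_reals all_analysis.
From mathcomp Require Import measurable_realfun ring lra.
Import Order.TTheory GRing.Theory Num.Theory.
Import numFieldNormedType.Exports.

Set Implicit Arguments.
Unset Strict Implicit.
Unset Printing Implicit Defensive.

Local Open Scope classical_set_scope.
Local Open Scope ring_scope.

(** * Positive definite forms and their balls *)

Lemma sum_continuous (T : topologicalType) (R : realType) (I : Type)
    (s : seq I) (f : I -> T -> R) :
  (forall i, continuous (f i)) -> continuous (fun x => \sum_(i <- s) f i x).
Proof.
move=> cf; elim: s => [|i s ih] x.
  by under eq_fun do rewrite big_nil; exact: cvg_cst.
by under eq_fun do rewrite big_cons; apply: cvgD; [exact: cf|exact: ih].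
Qed.

Lemma mul_continuous (T : topologicalType) (R : realType) (f g : T -> R) :
  continuous f -> continuous g -> continuous (fun x => f x * g x).
Proof. by move=> cf cg x; apply: continuousM; [exact: cf|exact: cg]. Qed.

(** A neighbourhood of a matrix contains a product of neighbourhoods of its entries, and the entries
    are finitely many. *)
Lemma continuous_mx (T : topologicalType) (R : realType) m n
    (f : T -> 'M[R]_(m, n)) :
  (forall i j, continuous (fun x => f x i j)) -> continuous f.
Proof.
move=> cf x A [P nP PA].
apply: (filterS (P := [set y | forall i j, P i j (f y i j)])).
  by move=> y Py; exact: PA.
by apply: filter_forall => i; apply: filter_forall => j; apply: cf; exact: nP.
Qed.

Section Forms.
Context {R : realType} {n : nat}.
Implicit Types (M N P A B : 'M[R]_n) (x y z : 'rV[R]_n).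

Definition bform M x y : R := (x *m M *m y^T) 0 0.

Definition qform M x : R := bform M x x.

Definition posdef M : Prop := M^T = M /\ forall x, x != 0 -> 0 < qform M x.

Definition qball M : set 'rV[R]_n := [set x | qform M x <= 1].

Definition qsphere M : set 'rV[R]_n := [set x | qform M x = 1].

Lemma bformE M x y : bform M x y = \sum_i \sum_j x 0 i * M i j * y 0 j.
Proof.
rewrite /bform mxE exchange_big/=; apply: eq_bigr => j _.
by rewrite !mxE mulr_suml; apply: eq_bigr => i _.
Qed.

Lemma bform_trace M x y : bform M x y = \tr (M *m (y^T *m x)).
Proof. by rewrite mulmxA mxtrace_mulC mulmxA /bform /mxtrace big_ord1. Qed.

Lemma bformDl M x y z : bform M (x + y) z = bform M x z + bform M y z.
Proof. by rewrite /bform !mulmxDl mxE. Qed.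

Lemma bformZl M a x z : bform M (a *: x) z = a * bform M x z.
Proof. by rewrite /bform -!scalemxAl mxE. Qed.

Lemma bformC M x y : M^T = M -> bform M x y = bform M y x.
Proof.
move=> sM; rewrite /bform -[in LHS]sM.
by rewrite -{1}[x]trmxK -trmx_mul -trmx_mul mxE mulmxA.
Qed.

Lemma bformDr M x y z : bform M x (y + z) = bform M x y + bform M x z.
Proof. by rewrite /bform linearD/= mulmxDr mxE. Qed.

Lemma bformZr M a x z : bform M x (a *: z) = a * bform M x z.
Proof. by rewrite /bform linearZ/= -scalemxAr mxE. Qed.

Lemma bform_mul M x A y B : bform M (x *m A) (y *m B) = bform (A *m M *m B^T) x y.
Proof. by rewrite /bform trmx_mul !mulmxA. Qed.

Lemma qform_mul M x A : qform M (x *m A) = qform (A *m M *m A^T) x.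
Proof. exact: bform_mul. Qed.

Lemma bformDm M N x y : bform (M + N) x y = bform M x y + bform N x y.
Proof. by rewrite /bform mulmxDr mulmxDl mxE. Qed.

Lemma bformZm a M x y : bform (a *: M) x y = a * bform M x y.
Proof. by rewrite /bform -scalemxAr -scalemxAl mxE. Qed.

Lemma bform_trmx M x y : bform M^T x y = bform M y x.
Proof.
rewrite /bform.
by rewrite -{1}[x]trmxK -trmx_mul -trmx_mul mxE mulmxA.
Qed.

Lemma qform_trmx M x : qform M^T x = qform M x.
Proof. exact: bform_trmx. Qed.

Lemma qformDm M N x : qform (M + N) x = qform M x + qform N x.
Proof. exact: bformDm. Qed.

Lemma qformZm a M x : qform (a *: M) x = a * qform M x.
Proof. exact: bformZm. Qed.

Lemma qformBm M N x : qform (M - N) x = qform M x - qform N x.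
Proof. by rewrite qformDm -scaleN1r qformZm mulN1r. Qed.

Lemma qformZ M a x : qform M (a *: x) = a ^+ 2 * qform M x.
Proof. by rewrite /qform bformZl bformZr mulrA. Qed.

Lemma qform0 M : qform M 0 = 0.
Proof. by rewrite -(scale0r 0) qformZ expr0n mul0r. Qed.

Lemma qformD M x y : M^T = M ->
  qform M (x + y) = qform M x + 2 * bform M x y + qform M y.
Proof.
move=> sM; rewrite /qform !bformDl !bformDr (bformC y x sM); ring.
Qed.

Lemma bform_delta M i j : bform M (delta_mx 0 i) (delta_mx 0 j) = M i j.
Proof. by rewrite /bform -rowE trmx_delta -colE !mxE. Qed.

Lemma sym_qform_inj M N : M^T = M -> N^T = N ->
  (forall x, qform M x = qform N x) -> M = N.
Proof.
move=> sM sN MN; apply/matrixP => i j; rewrite -!bform_delta.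
have := MN (delta_mx 0 i + delta_mx 0 j).
by rewrite !qformD// !MN; lra.
Qed.

(** The square of a linear form is the quadratic form of a rank-one matrix; this brings isotropy
    down to second moments. *)
Lemma bform_sqr P x t : P^T = P ->
  bform P x t ^+ 2 = qform (P *m t^T *m t *m P) x.
Proof.
move=> sP; rewrite expr2 {2}(bformC _ _ sP) /qform /bform.
have -> : x *m (P *m t^T *m t *m P) *m x^T = (x *m P *m t^T) *m (t *m P *m x^T).
  by rewrite !mulmxA.
by rewrite [RHS]mxE big_ord1.
Qed.

Lemma bform_continuous M y : continuous (fun x => bform M x y).
Proof.
rewrite (funext (fun x => bformE M x y)).
apply: sum_continuous => i; apply: sum_continuous => j.
do 2![apply: mul_continuous; last exact: cst_continuous].
exact: coord_continuous.
Qed.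

Lemma bform_sqr_continuous M y : continuous (fun x => bform M x y ^+ 2).
Proof.
rewrite (funext (fun x => expr2 (bform M x y))).
by apply: mul_continuous; exact: bform_continuous.
Qed.

Lemma qform_continuous M : continuous (qform M).
Proof.
rewrite /qform (funext (fun x => bformE M x x)).
apply: sum_continuous => i; apply: sum_continuous => j.
apply: mul_continuous; last exact: coord_continuous.
apply: mul_continuous; last exact: cst_continuous.
exact: coord_continuous.
Qed.

Lemma posdef_ge0 M x : posdef M -> 0 <= qform M x.
Proof.
by move=> [_ pM]; have [->|/pM/ltW//] := eqVneq x 0; rewrite qform0.
Qed.

Lemma posdef_eq0 M x : posdef M -> qform M x = 0 -> x = 0.
Proof.
move=> [_ pM]; have [//|/pM] := eqVneq x 0.
by rewrite lt_neqAle eq_sym => /andP[/eqP].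
Qed.

Lemma posdef_unitmx M : posdef M -> M \in unitmx.
Proof.
move=> pM; rewrite -row_free_unit -kermx_eq0; apply/eqP/row_matrixP => i.
rewrite row0; apply: (posdef_eq0 pM).
by rewrite /qform /bform -row_mul mulmx_ker row0 mul0mx mxE.
Qed.

Lemma posdef_inv M : posdef M -> posdef (invmx M).
Proof.
move=> pM; have uM := posdef_unitmx pM; split.
  by rewrite trmx_inv pM.1.
move=> x x0; have := pM.2 (x *m invmx M); rewrite qform_mul trmx_inv pM.1.
rewrite mulVmx// mul1mx; apply; apply: contra x0 => /eqP.
by move=> /(congr1 (mulmx^~ M)); rewrite mulmxKV// mul0mx => ->.
Qed.

(* A positive definite form dominates every continuous 2-homogeneous function,
   by compactness of the unit sphere of R^n. *)
Lemma posdef_dominates M (g : 'rV[R]_n -> R) : posdef M -> continuous g ->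
  (forall a x, g (a *: x) = a ^+ 2 * g x) ->
  exists2 C, 0 < C & forall x, g x <= C * qform M x.
Proof.
move=> pM cg hg; pose S := [set x : 'rV[R]_n | `|x| = 1].
have g0 : g 0 = 0 by rewrite -(scale0r 0) hg expr0n mul0r.
have [[s Ss]|S0] := pselect (S !=set0); last first.
  (* An empty unit sphere means that the space is zero. *)
  exists 1 => // x; suff -> : x = 0 by rewrite g0 qform0 mulr0.
  apply: contrapT => /eqP x0; apply: S0; exists (`|x|^-1 *: x).
  by rewrite /S/= normrZ ger0_norm ?invr_ge0// mulVf// normr_eq0.
have cS : compact S.
  apply: bounded_closed_compact.
    by exists 1; split => // t t1 x; rewrite /S/= => ->; exact: ltW.
  rewrite (_ : S = (fun x : 'rV[R]_n => `|x|) @^-1` [set 1]); last by [].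
  apply: preimage_closed; last exact: (@closed_eq R).
  by move=> ? _; exact: norm_continuous.
have [b bS mb] := EVT_min_rV (ex_intro _ s Ss) cS
  (continuous_subspaceT (@qform_continuous M)).
have [c cS' mc] := EVT_max_rV (ex_intro _ s Ss) cS (continuous_subspaceT cg).
have qb : 0 < qform M b.
  apply: pM.2; apply/eqP => b0; move: bS; rewrite inE /S/= b0 normr0.
  by move=> /esym/eqP; rewrite oner_eq0.
(* On the sphere [g] is at most [g c] and the form at least [qform M b]; the added 1 keeps the
   constant positive. *)
exists ((`|g c| + 1) / qform M b); first by rewrite divr_gt0// ltr_wpDl.
move=> x; have [->|x0] := eqVneq x 0; first by rewrite g0 qform0 mulr0.
have nx0 : `|x| != 0 by rewrite normr_eq0.
have -> : x = `|x| *: (`|x|^-1 *: x) by rewrite scalerA divff// scale1r.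
have xS : (`|x|^-1 *: x) \in S.
  by rewrite inE /S/= normrZ ger0_norm ?invr_ge0// mulVf.
rewrite hg qformZ mulrCA ler_wpM2l ?sqr_ge0//.
have := mc _ xS; have := mb _ xS => h1 h2; apply: (le_trans h2).
apply: (@le_trans _ _ (`|g c| + 1)).
  by rewrite (le_trans (ler_norm _))// lerDl.
by rewrite mulrAC -mulrA ler_peMr// ?ler_pdivlMr ?mul1r// addr_ge0.
Qed.

Lemma posdef_dominates_qform M N : posdef M ->
  exists2 C, 0 < C & forall x, qform N x <= C * qform M x.
Proof.
move=> pM; apply: posdef_dominates => //; first exact: qform_continuous.
by move=> a x; rewrite qformZ.
Qed.

Lemma qball_compact M : posdef M -> compact (qball M).
Proof.
move=> pM; have [|a x|C C0 hC] := @posdef_dominates M (fun x => `|x| * `|x|) pM.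
- by apply: mul_continuous => x; exact: norm_continuous.
- by rewrite normrZ mulrACA -!expr2 real_normK ?num_real.
apply: bounded_closed_compact; last first.
  by apply: (@preimage_closed _ _ (qform M) [set y | y <= 1]);
    [move=> ? _; exact: qform_continuous|exact: closed_le].
exists (1 + C); split; first exact: num_real.
move=> t Ct x /= qx; apply: le_trans (ltW Ct).
have {}hC : `|x| * `|x| <= C.
  by apply: (le_trans (hC x)); rewrite ler_piMr// ltW.
by have := sqr_ge0 (`|x| - 1); nra.
Qed.

(** Dilating a point of the sphere by [1 + e / 2] leaves the ball, so the point is not interior; a
    point with [qform M x < 1] is interior since this condition is open. *)
Lemma boundary_qball M : posdef M -> boundary (qball M) = qsphere M.
Proof.
move=> pM; have clM : closed (qball M).
  exact: (compact_closed (@norm_hausdorff _ _) (qball_compact pM)).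
apply/seteqP; split => x; rewrite /boundary /=; last first.
  move=> x1; split; first by apply: subset_closure; rewrite /qball/= x1.
  have cf : continuous (fun a : R => a *: x) by exact: scalel_continuous.
  move=> xi; have : nbhs (1 : R) ((fun a : R => a *: x) @^-1` qball M).
    by apply: cf; rewrite scale1r.
  rewrite -nbhs_ballE => -[e/= e0]; rewrite -ball_normE/= => /(_ (1 + e / 2)).
  rewrite /= opprD addrA subrr add0r normrN gtr0_norm ?divr_gt0//.
  rewrite ltr_pdivrMr// ltr_pMr// ltr1n => /(_ isT).
  by rewrite /qball/= qformZ x1 mulr1; nra.
rewrite -(closure_id (qball M)).1// => -[x1 nx]; apply/eqP.
rewrite eq_le x1/= leNgt; apply/negP => lx; apply: nx.
apply: (@interiorS _ [set y | qform M y < 1]).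
  by move=> y /ltW.
rewrite (interior_id _).1//.
by apply: (@open_comp _ _ (qform M) [set y | y < 1]);
  [move=> ? _; exact: qform_continuous|exact: open_lt].
Qed.

Lemma body_norm_qball M x : posdef M -> body_norm (qball M) x ^+ 2 = qform M x.
Proof.
move=> pM; have q0 := posdef_ge0 x pM.
suff -> : body_norm (qball M) x = Num.sqrt (qform M x) by rewrite sqr_sqrtr.
rewrite /body_norm; set S := [set l : R | _].
have SE : S = [set l | 0 < l /\ Num.sqrt (qform M x) <= l].
  apply/seteqP; split => l /= [l0 hl]; split => //.
    case: hl => y; rewrite /qball/= => qy <-; rewrite qformZ sqrtrM ?sqr_ge0//.
    rewrite sqrtr_sqr gtr0_norm// ler_piMr ?(ltW l0)//.
    by rewrite -[leRHS](sqrtr1 R) ler_wsqrtr.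
  exists (l^-1 *: x); last by rewrite scalerA divff ?gt_eqF// scale1r.
  rewrite /qball/= qformZ exprVn mulrC ler_pdivrMr ?exprn_gt0// mul1r.
  by rewrite -(sqr_sqrtr q0) ler_pXn2r// nnegrE ?sqrtr_ge0// ltW.
have lbS : lbound S (Num.sqrt (qform M x)) by rewrite SE => l [].
apply/eqP; rewrite eq_le; apply/andP; split; last first.
  apply: lb_le_inf => //; exists (Num.sqrt (qform M x) + 1).
  by rewrite SE/=; split; [rewrite ltr_wpDl ?sqrtr_ge0|rewrite lerDl].
(* For [x = 0] the root is 0, which [0 < l] excludes from [S]: the infimum is approached but not
   attained, hence the margin [e]. *)
apply/ler_addgt0Pr => e e0; apply: ge_inf; first by exists (Num.sqrt (qform M x)).
by rewrite SE/=; split; [rewrite ltr_wpDl ?sqrtr_ge0|rewrite lerDl ltW].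
Qed.

End Forms.

(** * Ellipsoids inside a convex body *)

Section Ellipsoids.
Context {R : realType} {n : nat}.
Implicit Types (M N P A B : 'M[R]_n) (x y z : 'rV[R]_n) (K E F : set 'rV[R]_n).

Lemma dot_bform (q : {dot 'rV[R]_n for (@idfun R)}) :
  exists2 P, posdef P & (q : 'rV[R]_n -> 'rV[R]_n -> R) = bform P.
Proof.
pose P : 'M[R]_n := \matrix_(i, j) q (delta_mx 0 i) (delta_mx 0 j).
have qC x y : q x y = q y x.
  by rewrite (hermitian_subproof (s := q)) expr0 mul1r.
have qE x y : q x y = bform P x y.
  rewrite bformE {1}(row_sum_delta x) linear_sumlz.
  apply: eq_bigr => i _; rewrite linearZl_LR {1}(row_sum_delta y).
  rewrite linear_sumr mulr_sumr; apply: eq_bigr => j _.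
  by rewrite linearZr_LR/= mxE -mulrA [y 0 j * _]mulrC.
exists P; last by apply/funext => x; apply/funext => y.
split; first by apply/matrixP => i j; rewrite !mxE qC.
by move=> x x0; rewrite /qform -qE; exact: neq0_dnorm_gt0.
Qed.

(** The proof [pP] is an argument so that the dot product instances below can refer to it. *)
Definition posdef_form P (pP : posdef P) := bform P.

Fact posdef_form_bilinear P (pP : posdef P) :
  bilinear_for *%R (@idfun R \; *%R) (posdef_form pP).
Proof.
split=> [y a x z|x a y z].
  by rewrite /posdef_form bformDl bformZl.
by rewrite /posdef_form bformDr bformZr.
Qed.

Fact posdef_form_hermitian P (pP : posdef P) x y :
  posdef_form pP x y = (-1) ^+ false * idfun (posdef_form pP y x).
Proof. by rewrite expr0 mul1r /posdef_form (bformC _ _ pP.1). Qed.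

Fact posdef_form_gt0 P (pP : posdef P) x : x != 0 -> 0 < posdef_form pP x x.
Proof. exact: pP.2. Qed.

HB.instance Definition _ P (pP : posdef P) :=
  bilinear_isBilinear.Build R 'rV[R]_n 'rV[R]_n R *%R (@idfun R \; *%R)
    (posdef_form pP) (posdef_form_bilinear pP).
HB.instance Definition _ P (pP : posdef P) :=
  isHermitianSesquilinear.Build R 'rV[R]_n false (@idfun R)
    (posdef_form pP) (posdef_form_hermitian pP).
HB.instance Definition _ P (pP : posdef P) :=
  isDotProduct.Build R 'rV[R]_n (posdef_form pP) (posdef_form_gt0 pP).

Lemma qball_ellipsoid P : posdef P -> ellipsoid (qball P).
Proof.
move=> pP; exists (bform P).
by exists (posdef_form pP : {dot 'rV[R]_n for (@idfun R)}).
Qed.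

(** The matrix is extracted from the product that [get] chooses, so that a single [P] describes both
    the ball and [eprod E]. *)
Lemma ellipsoidP E : ellipsoid E ->
  exists P, [/\ posdef P, E = qball P & eprod E = bform P].
Proof.
move=> /getPex; rewrite -/(eprod E) => -[q [-> EE]].
by have [P pP qP] := dot_bform q; exists P; rewrite EE qP.
Qed.

Lemma convex_setE K : @convex_set R 'rV[R]_n K ->
  forall x y (t : R), 0 <= t <= 1 -> K x -> K y -> K (t *: x + (1 - t) *: y).
Proof.
move=> cK x y t t01 Kx Ky; have := cK x y (Itv01 (andP t01).1 (andP t01).2).
by rewrite !inE => /(_ Kx Ky).
Qed.

(** The preimage of [interior K] under the affine map [f] is open, lies in [K] by convexity, and
    contains the given combination. *)
Lemma convex_interior K x y (t : R) : @convex_set R 'rV[R]_n K ->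
  0 <= t < 1 -> K x -> interior K y -> interior K (t *: x + (1 - t) *: y).
Proof.
move=> /convex_setE cK /andP[t0 t1] Kx Ky.
pose f z : 'rV[R]_n := (1 - t)^-1 *: (z - t *: x).
have t1' : 1 - t != 0 by rewrite subr_eq0 gt_eqF.
have cf : continuous f.
  move=> z; apply: continuous_comp; last exact: scaler_continuous.
  by apply: continuousB; [exact: cvg_id|exact: cst_continuous].
have of_ : open (f @^-1` interior K).
  by apply: open_comp; [move=> ? _; exact: cf|exact: open_interior].
suff : f @^-1` interior K `<=` interior K.
  by apply; rewrite /f/= addrAC subrr add0r scalerA mulVf// scale1r.
rewrite -open_subsetE// => z /interior_subset Kfz.
have -> : z = t *: x + (1 - t) *: f z.
  by rewrite /f scalerA divff// scale1r addrC subrK.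
by apply: cK => //; rewrite t0 ltW.
Qed.

(* If some y in K had <x, y>_A > 1 then x would be a convex combination of y
   and an interior point of the ball, hence interior to K. *)
Lemma contact_supporting A K x y : posdef A -> @convex_set R 'rV[R]_n K ->
  qball A `<=` K -> boundary K x -> qform A x = 1 -> K y -> bform A x y <= 1.
Proof.
move=> pA cK AK [_ nKx] qx Ky; rewrite leNgt; apply/negP => lxy; apply: nKx.
set c := bform A x y in lxy; set d := qform A y.
have d0 : 0 <= d := posdef_ge0 y pA.
(* For [t] in (0, 1) and [x = t *: y + (1 - t) *: z], the bound [qform A z < 1] amounts to
   [t * (d - 1) < 2 * (c - 1)], which this [t] satisfies. *)
pose t := (c - 1) / (c + d).
have cd : 0 < c + d by lra.
have t0 : 0 < t by rewrite divr_gt0// subr_gt0.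
have t1 : t < 1 by rewrite ltr_pdivrMr//; lra.
have tcd : t * (c + d) = c - 1 by rewrite mulfVK// gt_eqF.
clearbody t.
pose z := (1 - t)^-1 *: (x - t *: y).
have -> : x = t *: y + (1 - t) *: z.
  by rewrite /z scalerA divff ?subr_eq0 ?gt_eqF// scale1r addrC subrK.
apply: convex_interior => //; first by rewrite ltW.
apply: (interiorS AK).
suff zi : [set y | qform A y < 1] z.
  apply: (@interiorS _ [set y | qform A y < 1]); first by move=> w /ltW.
  rewrite (interior_id _).1//.
  by apply: (@open_comp _ _ (qform A) [set y | y < 1]);
    [move=> ? _; exact: qform_continuous|exact: open_lt].
rewrite /= /z qformZ -scaleNr qformD ?pA.1// bformZr qx -/c qformZ -/d exprVn mulrC.
rewrite ltr_pdivrMr ?exprn_gt0 ?subr_gt0// mul1r sqrrN.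
have : t * d <= c - 1 by rewrite -tcd; nra.
nra.
Qed.

(** The form [bform A x] is largest on [qball B] at the multiple of [z] on its boundary, where it
    equals [Num.sqrt c]; the supporting hyperplane at [x] bounds this by 1. *)
Lemma contact_dual_form A B K x : posdef A -> posdef B ->
  @convex_set R 'rV[R]_n K -> qball A `<=` K -> qball B `<=` K ->
  boundary K x -> qform A x = 1 -> qform (A *m invmx B *m A) x <= 1.
Proof.
move=> pA pB cK AK BK bKx qx; have uB := posdef_unitmx pB.
set c := qform _ x; pose z := x *m (A *m invmx B).
have pC : (invmx B)^T = invmx B by rewrite trmx_inv pB.1.
have zA : bform A x z = c.
  by rewrite -{1}[x]mulmx1 bform_mul mul1mx trmx_mul pC pA.1 mulmxA.
have zB : qform B z = c.
  rewrite qform_mul trmx_mul pC pA.1 -!mulmxA (mulmxA (invmx B) B) mulVmx//.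
  by rewrite mul1mx mulmxA.
have c0 : 0 <= c by rewrite -zB; exact: posdef_ge0.
rewrite leNgt; apply/negP => c1.
have s0 : 0 < Num.sqrt c by rewrite sqrtr_gt0; lra.
have : bform A x ((Num.sqrt c)^-1 *: z) <= 1.
  apply: (contact_supporting (K := K)) => //; apply: BK.
  by rewrite /qball/= qformZ zB exprVn sqr_sqrtr// mulVf// gt_eqF//; lra.
rewrite bformZr zA mulrC ler_pdivrMr// mul1r -[leLHS](sqr_sqrtr c0).
have : 1 < Num.sqrt c by rewrite -(sqrtr1 R) ltr_sqrt//; lra.
nra.
Qed.

End Ellipsoids.

(** * Conic combinations of points of a compact set *)

Section ConicHull.
Context {R : realType} {m : nat}.
Implicit Types (S : set 'rV[R]_m) (a v w s H : 'rV[R]_m).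

Definition dotr (u v : 'rV[R]_m) : R := (u *m v^T) 0 0.

Lemma dotrE u v : dotr u v = \sum_j u 0 j * v 0 j.
Proof. by rewrite /dotr mxE; apply: eq_bigr => j _; rewrite mxE. Qed.

Lemma dotrC u v : dotr u v = dotr v u.
Proof. by rewrite !dotrE; apply: eq_bigr => j _; rewrite mulrC. Qed.

Lemma dotrDr u v w : dotr u (v + w) = dotr u v + dotr u w.
Proof. by rewrite /dotr linearD/= mulmxDr mxE. Qed.

Lemma dotrZr u (c : R) v : dotr u (c *: v) = c * dotr u v.
Proof. by rewrite /dotr linearZ/= -scalemxAr mxE. Qed.

Lemma dotrDl u v w : dotr (u + v) w = dotr u w + dotr v w.
Proof. by rewrite ![dotr _ w]dotrC dotrDr. Qed.

Lemma dotrZl u (c : R) v : dotr (c *: u) v = c * dotr u v.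
Proof. by rewrite ![dotr _ v]dotrC dotrZr. Qed.

Lemma dotr_line u v (t : R) : dotr (u + t *: v) (u + t *: v) =
  dotr u u + 2 * t * dotr u v + t ^+ 2 * dotr v v.
Proof. rewrite !dotrDl !dotrDr !dotrZl !dotrZr (dotrC v u); ring. Qed.

Lemma dotr_ge0 u : 0 <= dotr u u.
Proof. by rewrite dotrE sumr_ge0// => i _; rewrite -expr2 sqr_ge0. Qed.

Lemma dotr_eq0 u : dotr u u = 0 -> u = 0.
Proof.
rewrite dotrE => /eqP; rewrite psumr_eq0; last first.
  by move=> i _; rewrite -expr2 sqr_ge0.
move=> /allP u0; apply/rowP => j; rewrite mxE; apply/eqP.
by have := u0 j (mem_index_enum j); rewrite /= mulf_eq0 orbb.
Qed.

Lemma dotr_continuous (T : topologicalType) (f g : T -> 'rV[R]_m) :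
  continuous f -> continuous g -> continuous (fun x => dotr (f x) (g x)).
Proof.
move=> cf cg; rewrite (funext (fun x => dotrE (f x) (g x))).
apply: sum_continuous => j.
have cj (h : T -> 'rV[R]_m) : continuous h -> continuous (fun x => h x 0 j).
  move=> ch x.
  apply: (@continuous_comp _ _ _ h (fun M : 'rV[R]_m => M 0 j)).
    exact: ch.
  exact: coord_continuous.
by apply: mul_continuous; exact: cj.
Qed.

(** The sum of the coefficients is left free, which makes compactness a plain induction on [k]. When
    [dotr a] is 1 on [S], the condition [dotr a w = 1] singles out the convex combinations. *)
Definition combs S k : set 'rV[R]_m :=
  [set w | exists (c : 'I_k -> R) (X : 'I_k -> 'rV[R]_m),
    [/\ forall i, 0 <= c i <= 1, forall i, S (X i) & w = \sum_i c i *: X i]].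

Lemma combsS S k : combs S k.+1 =
  (fun p : (R * 'rV[R]_m) * 'rV[R]_m => p.1.1 *: p.1.2 + p.2) @`
    ((`[0, 1] `*` S) `*` combs S k).
Proof.
apply/seteqP; split => w.
  move=> [c [X [c01 SX ->]]]; rewrite big_ord_recl.
  exists ((c ord0, X ord0), \sum_(i < k) c (lift ord0 i) *: X (lift ord0 i)) => //.
  split; first by split => //=; rewrite in_itv/=.
  by exists (c \o lift ord0), (X \o lift ord0); split => //= i.
move=> [[[t s] w'] [[/=]]]; rewrite in_itv/= => t01 Ss [c [X [c01 SX ->]]] <-.
exists (fun i => if unlift ord0 i is Some j then c j else t).
exists (fun i => if unlift ord0 i is Some j then X j else s).
split=> [i|i|]; try by case: unliftP.
rewrite big_ord_recl unlift_none; congr (_ + _).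
by apply: eq_bigr => i _; rewrite liftK.
Qed.

Lemma compact_combs S k : compact S -> compact (combs S k).
Proof.
move=> cS; elim: k => [|k ih].
  rewrite (_ : combs S 0 = [set 0]); first exact: compact_set1.
  apply/seteqP; split => w.
    by move=> [c [X [_ _ ->]]]; rewrite big_ord0.
  by move=> ->; exists (fun=> 0), (fun=> 0); split; [case|case|rewrite big_ord0].
rewrite combsS; apply: continuous_compact; last first.
  apply: compact_setX => //; apply: compact_setX => //.
  exact: segment_compact.
apply: continuous_subspaceT => p.
apply: (@continuousD _ _ _ (fun p : (R * 'rV[R]_m) * 'rV[R]_m => p.1.1 *: p.1.2)
  snd); last exact: cvg_snd.
apply: (@continuousZ _ _ _ (fun p : (R * 'rV[R]_m) * 'rV[R]_m => p.1.1)
  (fun p => p.1.2)).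
  by apply: (continuous_comp (f := fst) (g := fst)); exact: cvg_fst.
by apply: (continuous_comp (f := fst) (g := snd));
  [exact: cvg_fst|exact: cvg_snd].
Qed.

(* Caratheodory's argument, one step: more than [m] vectors are linearly
   dependent, and moving along the dependency kills one coefficient. *)
Lemma cone_reduce k (c : 'I_k.+1 -> R) (X : 'I_k.+1 -> 'rV[R]_m) : (m <= k)%N ->
  (forall i, 0 <= c i) ->
  exists (i0 : 'I_k.+1) (d : 'I_k -> R), (forall i, 0 <= d i) /\
    \sum_i c i *: X i = \sum_i d i *: X (lift i0 i).
Proof.
move=> mk c0.
have [u [i ui] uX] : exists2 u : 'rV[R]_k.+1, exists i, 0 < u 0 i &
    \sum_i u 0 i *: X i = 0.
  pose A := \matrix_i X i.
  have /rowV0Pn[v vA v0] : kermx A != 0.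
    by rewrite kermx_eq0 /row_free neq_ltn ltnS (leq_trans (rank_leq_col A)).
  have {vA}vA : \sum_i v 0 i *: X i = 0.
    transitivity (v *m A); last exact/sub_kermxP.
    by rewrite mulmx_sum_row; apply: eq_bigr => i _; rewrite rowK.
  have [i vi] : exists i, v 0 i != 0 by apply/rV0Pn.
  have [vi0|vi0] := ltP 0 (v 0 i); first by exists v => //; exists i.
  exists (- v); first by exists i; rewrite mxE oppr_gt0 lt_neqAle vi.
  under eq_bigr do rewrite mxE scaleNr.
  by rewrite sumrN vA oppr0.
(* The least ratio [c i / u 0 i] over positive [u 0 i] is the largest multiple of [u] that can be
   subtracted with all coefficients staying nonnegative. *)
have [i0 ui0 mi0] := @arg_minP _ _ _ i (fun i => 0 < u 0 i)
  (fun i => c i / u 0 i) ui.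
set t := c i0 / u 0 i0 in mi0.
exists i0, (fun j => c (lift i0 j) - t * u 0 (lift i0 j)); split => [j|].
  set l := lift i0 j; have [ul|ul] := ltP 0 (u 0 l).
    by rewrite subr_ge0 -ler_pdivlMr// mi0.
  by rewrite subr_ge0 (le_trans _ (c0 l))// mulr_ge0_le0// divr_ge0// ltW.
transitivity (\sum_i (c i - t * u 0 i) *: X i).
  under [RHS]eq_bigr do rewrite scalerBl -scalerA.
  by rewrite big_split/= sumrN -scaler_sumr uX scaler0 subr0.
rewrite (bigD1_ord i0)//= [X in X *: _](_ : _ = 0) ?scale0r ?add0r//.
by rewrite /t mulfVK ?gt_eqF// subrr.
Qed.

(** The reduction yields nonnegative coefficients only; applying [dotr a] shows that they sum to 1,
    so each is at most 1. *)
Lemma combs_reduce S a k w : (forall s, S s -> dotr a s = 1) -> dotr a w = 1 ->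
  (m <= k)%N -> combs S k.+1 w -> combs S k w.
Proof.
move=> aS aw mk [c [X [c01 SX wE]]].
have [|i0 [d [d0 dE]]] := @cone_reduce k c X mk.
  by move=> i; have /andP[] := c01 i.
exists d, (X \o lift i0); split=> [i|i|]; [|exact: SX|by rewrite wE].
have dsum : \sum_i d i = 1.
  rewrite -[RHS]aw wE dE; elim/big_ind2 : _ => [|x1 x2 y1 y2 -> ->|j _].
  - by rewrite -(scale0r a) dotrZr mul0r.
  - by rewrite dotrDr.
  - by rewrite dotrZr aS// mulr1.
rewrite d0 -dsum (bigD1 i)//= lerDl sumr_ge0// => j _; exact: d0.
Qed.

(* The nearest point [w] to [v] among the convex combinations of at most [m]
   points of [S] is, by Caratheodory, the nearest one in the whole convex hull:
   its first-order optimality condition gives the separating functional. *)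
Lemma conic_separation S a v : compact S -> (forall s, S s -> dotr a s = 1) ->
  dotr a v = 1 ->
  combs S m v \/
  exists H, (forall s, S s -> 0 < dotr H s) /\ dotr H v < 0.
Proof.
move=> cS aS av; pose D := [set w | combs S m w /\ dotr a w = 1].
have aC : continuous (dotr a).
  apply: (@dotr_continuous _ (fun=> a) id); first exact: cst_continuous.
  by move=> x; exact: cvg_id.
have cD : compact D.
  apply: (@subclosed_compact _ D (combs S m)).
  - rewrite (_ : D = combs S m `&` (dotr a @^-1` [set 1])); last by [].
    apply: closedI; last first.
      by apply: preimage_closed; [move=> ? _; exact: aC|exact: (@closed_eq R)].
    exact: (compact_closed (@norm_hausdorff _ _) (compact_combs cS)).
  - exact: compact_combs.
  - by move=> w [].
have [[s0 Ss0]|S0] := pselect (S !=set0); last first.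
  right; exists (- a); split=> [s Ss|]; first by case: S0; exists s.
  by rewrite -scaleN1r dotrZl av; lra.
have m0 : (0 < m)%N.
  rewrite lt0n; apply/eqP => m0; move: av; rewrite dotrE big1.
    by move=> /esym/eqP; rewrite oner_eq0.
  by move=> [i im]; exfalso; rewrite m0 in im.
have Ds : D s0.
  split; last exact: aS.
  exists (fun i : 'I_m => (i == Ordinal m0)%:R), (fun=> s0).
  split=> // [i|]; first by case: (_ == _); rewrite ?lexx ?ler01.
  rewrite (bigD1 (Ordinal m0))//= scale1r big1 ?addr0// => i /negbTE ->.
  by rewrite scale0r.
have [|w Dw mw] := EVT_min_rV (ex_intro _ s0 Ds) cD
  (f := fun w => dotr (w - v) (w - v)).
  apply: continuous_subspaceT; apply: dotr_continuous => x;
    by apply: continuousB; [exact: cvg_id|exact: cst_continuous].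
move: Dw; rewrite inE => -[Cw aw].
have [->|wv] := eqVneq v w; first by left.
right; pose g := w - v; have g0 : 0 < dotr g g.
  rewrite lt_neqAle dotr_ge0 andbT eq_sym; apply: contra wv => /eqP/dotr_eq0.
  by move=> /eqP; rewrite subr_eq0 eq_sym.
have opt s : S s -> 0 <= dotr g (s - w).
  move=> Ss; have step t : 0 < t <= 1 ->
      dotr g g <= dotr (g + t *: (s - w)) (g + t *: (s - w)).
    move=> /andP[t0 t1]; rewrite (_ : g + _ = (w + t *: (s - w)) - v); last first.
      by rewrite addrAC.
    have aE : dotr a (w + t *: (s - w)) = 1.
      by rewrite dotrDr dotrZr dotrDr -scaleN1r dotrZr (aS _ Ss) aw; lra.
    apply: mw; rewrite inE; split => //.
    (* The moved point uses [m.+1] points of [S]; the reduction brings it back among the competitors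
       of [w]. *)
    apply: (combs_reduce aS) => //; rewrite combsS.
    have -> : w + t *: (s - w) = t *: s + (1 - t) *: w.
      by rewrite scalerBr scalerBl scale1r addrCA.
    exists ((t, s), (1 - t) *: w) => //; split.
      by split => //=; rewrite in_itv/= t1 ltW.
    case: Cw => c [X [c01 SX ->]]; exists (fun i => (1 - t) * c i), X.
    split => // [i|]; last by rewrite scaler_sumr; under eq_bigr do rewrite scalerA.
    by have /andP[? ?] := c01 i; apply/andP; split; nra.
  rewrite leNgt; apply/negP; set q := dotr g (s - w) => q0.
  set r := dotr (s - w) (s - w); have r0 : 0 <= r by exact: dotr_ge0.
  have rq : 0 < r - q by lra.
  (* With this step length the increment [2 * t * q + t ^+ 2 * r] equals [t * q * (1 + t)], which is
     negative; the choice also covers [r = 0]. *)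
  have tq : (- q / (r - q)) * (r - q) = - q by rewrite mulfVK// gt_eqF.
  have t01 : 0 < - q / (r - q) <= 1.
    by rewrite divr_gt0 ?oppr_gt0//= ler_pdivrMr//; lra.
  have := step _ t01; rewrite dotr_line -/q -/r; move: tq t01.
  set t := _ / _ => tq /andP[t0 t1].
  nra.
(* Since [dotr a] is 1 at [v] and on [S], subtracting a multiple of [a] moves the threshold to 0; it
   is taken halfway between [dotr g v] and [dotr g w]. *)
exists (g - (dotr g v + dotr g g / 2) *: a); split => [s Ss|].
  rewrite dotrDl -scaleNr dotrZl (aS _ Ss); have := opt s Ss.
  have : dotr g w = dotr g v + dotr g g.
    by rewrite -[in LHS](subrK v w) dotrDr addrC.
  by rewrite dotrDr -scaleN1r dotrZr; lra.
by rewrite dotrDl -scaleNr dotrZl av; lra.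
Qed.

End ConicHull.

(** * Second moments of measures *)

Section DiscreteMeasure.
Local Open Scope ereal_scope.
Context {d : measure_display} {T : measurableType d} {R : realType}.

(** A named sum on which the finite measure structure can be declared, for the induction on the
    number of atoms. *)
Definition finite_add (m1 m2 : {finite_measure set T -> \bar R}) :=
  measure_add m1 m2.

HB.instance Definition _ m1 m2 := Measure.on (finite_add m1 m2).

Fact finite_add_fin m1 m2 : fin_num_fun (finite_add m1 m2).
Proof.
move=> A mA; rewrite /finite_add measure_addE fin_numD.
by rewrite !fin_num_measure.
Qed.

HB.instance Definition _ m1 m2 :=
  Measure_isFinite.Build _ T R (finite_add m1 m2) (@finite_add_fin m1 m2).

Lemma discrete_measure k (c : 'I_k -> R) (X : 'I_k -> T) :
  (forall i, (0 <= c i)%R) ->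
  exists nu : {finite_measure set T -> \bar R},
    (forall A, nu A = \sum_i (c i)%:E * \d_(X i) A) /\
    forall f : T -> \bar R, measurable_fun setT f -> (forall x, 0 <= f x) ->
      \int[nu]_x f x = \sum_i (c i)%:E * f (X i).
Proof.
elim: k c X => [|k ih] c X c0.
  exists mzero; split=> [A|f mf f0]; first by rewrite big_ord0.
  by rewrite big_ord0 integral_measure_zero.
have [i|nu [nuE nuI]] := ih (c \o lift ord0) (X \o lift ord0); first exact: c0.
pose m : {finite_measure set T -> \bar R} :=
  mscale (NngNum (c0 ord0)) (dirac (X ord0)).
exists (finite_add m nu); split=> [A|f mf f0].
  rewrite big_ord_recl; transitivity (m A + nu A); first exact: measure_addE.
  by rewrite nuE.
rewrite big_ord_recl ge0_integral_measure_add// nuI//; congr (_ + _).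
by rewrite ge0_integral_mscale// integral_dirac// diracT mul1e.
Qed.

End DiscreteMeasure.

(** * Second moment matrices of Borel measures *)

Section Moments.
Context {R : realType} {n : nat}.
Implicit Types (M N P A B : 'M[R]_n) (D : set 'rV[R]_n).
Implicit Types nu : {finite_measure set (borelRV R n) -> \bar R}.

Lemma open_measurable_rV (U : set 'rV[R]_n) :
  open U -> measurable (U : set (borelRV R n)).
Proof. exact: sub_sigma_algebra. Qed.

Lemma closed_measurable_rV (U : set 'rV[R]_n) :
  closed U -> measurable (U : set (borelRV R n)).
Proof.
move=> cU; rewrite -[U]setCK; apply: measurableC.
by apply: open_measurable_rV; exact: closed_openC.
Qed.

Lemma compact_measurable_rV (U : set 'rV[R]_n) :
  compact U -> measurable (U : set (borelRV R n)).
Proof.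
move=> cU; apply: closed_measurable_rV.
exact: (compact_closed (@norm_hausdorff _ _) cU).
Qed.

Lemma continuous_measurable_rV (f : 'rV[R]_n -> R) :
  continuous f -> measurable_fun setT (f : borelRV R n -> R).
Proof.
move=> /continuousP cf; apply: (measurability _ (RGenOpens.measurableE R)).
move=> _ [_ [a [b ->] <-]]; rewrite setTI; apply: open_measurable_rV.
exact/cf/interval_open.
Qed.

Lemma continuous_integrable_rV nu D (f : 'rV[R]_n -> R) :
  compact D -> continuous f -> nu.-integrable D (EFin \o f).
Proof.
move=> cD cf; apply: measurable_bounded_integrable.
- exact: compact_measurable_rV.
- by rewrite ltey_eq fin_num_measure//; exact: compact_measurable_rV.
- by apply: measurable_funTS; exact: continuous_measurable_rV.
- have /compact_bounded[M [Mr hM]] : compact (f @` D).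
    by apply: continuous_compact => //; exact: continuous_subspaceT.
  by exists M; split => // x /hM h y Dy; apply: h; exists y.
Qed.

(** For compact [D] the integrals are finite, so [fine] loses nothing. *)
Definition moment nu D : 'M[R]_n :=
  \matrix_(i, j) fine (\int[nu]_(x in D) (x 0 i * x 0 j)%:E).

Lemma coord_mul_continuous i j : continuous (fun x : 'rV[R]_n => x 0 i * x 0 j).
Proof. by apply: mul_continuous; exact: coord_continuous. Qed.

Lemma integral_qform nu D M : compact D ->
  (\int[nu]_(x in D) (qform M x)%:E = (\tr (M *m moment nu D))%:E)%E.
Proof.
move=> cD; have mD : measurable (D : set (borelRV R n)).
  exact: compact_measurable_rV.
have iZ i j : nu.-integrable D (EFin \o (fun x : 'rV[R]_n => x 0 i * x 0 j)).
  exact/continuous_integrable_rV/coord_mul_continuous.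
have iMZ i j : nu.-integrable D
    (fun x : borelRV R n => (M i j)%:E * (x 0 i * x 0 j)%:E)%E.
  by apply: integrableZl => //; exact: iZ.
have -> : (fun x => (qform M x)%:E) = (fun x : borelRV R n =>
    \sum_i \sum_j (M i j)%:E * (x 0 i * x 0 j)%:E)%E.
  apply/funext => x; rewrite /qform bformE -sumEFin; apply: eq_bigr => i _.
  rewrite -sumEFin; apply: eq_bigr => j _.
  by rewrite -EFinM mulrCA mulrA.
rewrite integral_sum//; last first.
  by move=> i; apply: integrable_sum => // j _; exact: iMZ.
rewrite /mxtrace -sumEFin; apply: eq_bigr => i _.
rewrite integral_sum//.
rewrite mxE -sumEFin; apply: eq_bigr => j _.
rewrite integralZl//; last exact: iZ.
rewrite !mxE EFinM; congr (_ * _)%E.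
rewrite fineK; last exact: (integrable_fin_num mD (iZ j i)).
by apply: eq_integral => x _; rewrite mulrC.
Qed.

Lemma ge0_integral_supp nu D (f : 'rV[R]_n -> R) : compact D ->
  nu (~` D) = 0%E -> continuous f -> (forall x, 0 <= f x) ->
  (\int[nu]_x (f x)%:E = \int[nu]_(x in D) (f x)%:E)%E.
Proof.
move=> cD nuD cf f0; have mD := compact_measurable_rV cD.
rewrite (@ge0_negligible_integral _ _ _ _ setT (~` (D : set (borelRV R n))))//.
- by rewrite setTD setCK.
- exact: measurableC.
- by apply/measurable_EFinP; exact: continuous_measurable_rV.
- by move=> x _; rewrite lee_fin.
Qed.

Lemma moment_ge0 nu D M : compact D -> (forall x, D x -> 0 <= qform M x) ->
  0 <= \tr (M *m moment nu D).
Proof.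
by move=> cD M0; rewrite -lee_fin -integral_qform//; exact: integral_ge0.
Qed.

Lemma moment_eq1 nu D M : compact D -> (forall x, D x -> qform M x = 1) ->
  \tr (M *m moment nu D) = fine (nu D).
Proof.
move=> cD M1; apply: EFin_inj; rewrite -integral_qform//.
rewrite (eq_integral (cst 1%E)); last by move=> x; rewrite inE => /M1 ->.
rewrite integral_cst ?mul1e ?fineK//; last exact: compact_measurable_rV.
by rewrite fin_num_measure//; exact: compact_measurable_rV.
Qed.

Lemma moment_sym nu D : (moment nu D)^T = moment nu D.
Proof.
by apply/matrixP => i j; rewrite !mxE; under eq_integral do rewrite mulrC.
Qed.

Lemma integral_bform_sqr nu D P t : compact D -> nu (~` D) = 0%E ->
  P^T = P ->
  (\int[nu]_x (bform P x t ^+ 2)%:E = (qform (P *m moment nu D *m P) t)%:E)%E.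
Proof.
move=> cD nuD sP.
under eq_integral do rewrite (bform_sqr _ _ sP).
rewrite (ge0_integral_supp cD nuD).
- rewrite integral_qform//; congr EFin.
  rewrite /qform /bform -!mulmxA mxtrace_mulC -!mulmxA.
  by rewrite mxtrace_mulC /mxtrace big_ord1 !mulmxA.
- exact: qform_continuous.
- by move=> x; rewrite -bform_sqr// sqr_ge0.
Qed.

(** Isotropy says that the symmetric matrices [P *m S *m P] and [l *: P] have the same quadratic
    form; [P] is then cancelled on both sides. *)
Lemma isotropic_moment nu D P (l : R) : compact D -> nu (~` D) = 0%E ->
  posdef P ->
  (forall t, \int[nu]_x (bform P x t ^+ 2)%:E = (l * qform P t)%:E)%E ->
  moment nu D = l *: invmx P.
Proof.
move=> cD nuD pP isoP; have uP := posdef_unitmx pP.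
set S := moment nu D.
suff PSP : P *m S *m P = l *: P.
  have := congr1 (fun X => invmx P *m X *m invmx P) PSP.
  by rewrite !mulmxA mulVmx// mul1mx mulmxK// -scalemxAr mulVmx// -scalemxAl mul1mx.
apply: sym_qform_inj.
- by rewrite !trmx_mul pP.1 moment_sym mulmxA.
- by rewrite linearZ/= pP.1.
move=> t; apply: EFin_inj; rewrite qformZm -isoP.
by rewrite (integral_bform_sqr _ cD)// pP.1.
Qed.

(* The reflection exchanging two vectors of the same P-length shows that the
   second moment in a direction depends on its P-length only. *)
Lemma invariant_isotropic nu P : posdef P ->
  (forall T : {linear 'rV[R]_n -> 'rV[R]_n},
    (forall x y, bform P (T x) (T y) = bform P x y) ->
    forall A : set (borelRV R n), measurable A -> nu (T @^-1` A) = nu A) ->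
  forall s t, qform P s = qform P t ->
  (\int[nu]_x (bform P x s ^+ 2)%:E = \int[nu]_x (bform P x t ^+ 2)%:E)%E.
Proof.
move=> pP nuT s t st; have [->//|nst] := eqVneq s t.
have [u uE] : exists u, u = s - t by exists (s - t).
have u0 : qform P u != 0.
  by apply: contra nst => /eqP /(posdef_eq0 pP) /eqP; rewrite uE subr_eq0.
have [c cu] : exists c, c * qform P u = 2.
  by exists (2 / qform P u); rewrite mulfVK.
(* Right multiplication by [W] is the [P]-orthogonal reflection along [u]. *)
pose W := 1%:M - c *: (P *m u^T *m u).
have TE x : x *m W = x + (- c * bform P x u) *: u.
  rewrite mulNr scaleNr mulmxBr mulmx1 -scalemxAr !mulmxA -scalerA.
  congr (_ - _ *: _).
  by rewrite [x *m P *m u^T]mx11_scalar mul_scalar_mx.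
have Tiso x y : bform P (x *m W) (y *m W) = bform P x y.
  rewrite !TE !bformDl !bformDr !bformZl !bformZr -/(qform P u).
  rewrite (bformC u y pP.1).
  transitivity (bform P x y + c * bform P x u * bform P y u * (c * qform P u - 2)).
    ring.
  by rewrite cu subrr mulr0 addr0.
(* Equal lengths give [2 * bform P s u = qform P u], so the reflection subtracts exactly [u] from
   [s]. *)
have Ts : s *m W = t.
  rewrite TE mulNr; suff -> : c * bform P s u = 1.
    by rewrite scaleN1r uE opprB addrC subrK.
  apply: (mulfI (x := 2)); first by rewrite pnatr_eq0.
  rewrite mulr1 -[RHS]cu mulrCA; congr (c * _).
  rewrite uE -scaleN1r bformDr bformZr -/(qform P s) qformD ?pP.1// bformZr qformZ.
  by rewrite -st; ring.
have cW : continuous (fun x : 'rV[R]_n => x *m W).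
  rewrite (funext TE) => x.
  apply: (@continuousD _ _ _ id (fun x : 'rV[R]_n => (- c * bform P x u) *: u)).
    exact: cvg_id.
  apply: (@continuousZr_tmp _ _ _ (fun x : 'rV[R]_n => - c * bform P x u)).
  apply: mul_continuous; last exact: bform_continuous.
  exact: cst_continuous.
have mT : measurable_fun setT (mulmxr W : borelRV R n -> borelRV R n).
  apply: (measurability _ (erefl (@measurable _ (borelRV R n)))) => _ [A oA <-].
  rewrite setTI; apply: open_measurable_rV.
  by apply: open_comp oA => x _; exact: cW.
transitivity (\int[pushforward nu (mulmxr W : borelRV R n -> borelRV R n)]_x
  (bform P x t ^+ 2)%:E)%E.
  rewrite ge0_integral_pushforward//.
  - apply: eq_integral => x _; congr EFin; congr (_ ^+ 2).
    by rewrite /= -Ts Tiso.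
  - apply/measurable_EFinP; apply: continuous_measurable_rV.
    exact: bform_sqr_continuous.
  - by move=> y _; rewrite lee_fin sqr_ge0.
apply: eq_measure_integral => A mA _.
exact: (nuT (mulmxr W)).
Qed.

End Moments.

(** * Traces and contact points *)

Section Main.
Context {R : realType} {n : nat}.
Implicit Types (P A B G H M Y : 'M[R]_n) (x y t : 'rV[R]_n) (K E F : set 'rV[R]_n).
Implicit Types mu : probability (borelRV R n) R.

Lemma mxtrace_conj Q Y : \tr (Y *m Q *m Y^T) = \sum_j qform Q (row j Y).
Proof.
apply: eq_bigr => j _; rewrite /qform /bform -row_mul !mxE.
by apply: eq_bigr => k _; rewrite !mxE.
Qed.

(** Flattening turns the trace pairing into [dotr], so that conic separation applies to matrices. *)
Lemma dotr_mxvec A B : dotr (mxvec A) (mxvec B) = \tr (A *m B^T).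
Proof.
rewrite dotrE (reindex _ (curry_mxvec_bij _ _))/= /mxtrace.
under [RHS]eq_bigr do rewrite mxE.
rewrite pair_bigA; apply: eq_bigr => -[i j] _.
by rewrite !mxvecE !mxE.
Qed.

Lemma dotr_mxvec_qform A x : dotr (mxvec A) (mxvec (x^T *m x)) = qform A x.
Proof. by rewrite dotrC /dotr mxvec_dotmul. Qed.

Lemma boundary_closed K : closed (boundary K).
Proof.
rewrite /boundary setDE; apply: closedI; first exact: closed_closure.
exact/open_closedC/open_interior.
Qed.

Lemma qsphere_compact P : posdef P -> compact (qsphere P).
Proof.
move=> pP; apply: (subclosed_compact _ (qball_compact pP)).
  by rewrite -boundary_qball//; exact: boundary_closed.
by move=> x /= xP; rewrite /qball/= xP.
Qed.

Lemma contact_compact P K : posdef P -> compact (qsphere P `&` boundary K).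
Proof.
move=> pP; apply: (subclosed_compact _ (qsphere_compact pP)).
  apply: closedI; last exact: boundary_closed.
  by rewrite -boundary_qball//; exact: boundary_closed.
by move=> x [].
Qed.

(** By invariance the second moment along [t] is that along a unit vector [e] rescaled to the length
    of [t]. The trace against [P] is the total mass 1, whence [k * n%:R = 1], which also records
    that [n] is non-zero. *)
Lemma invariant_moment P mu : posdef P -> eprod (qball P) = bform P ->
  invariant_probability (qball P) mu ->
  exists k, [/\ 0 < k, k * n%:R = 1 & moment mu (qsphere P) = k *: invmx P].
Proof.
move=> pP eP [mu1 muT]; rewrite boundary_qball// in mu1.
have cS := qsphere_compact pP.
have mS := compact_measurable_rV cS.
have muS : mu (~` qsphere P) = 0%E.
  by rewrite probability_setC//= mu1 subee.
have [e e1] : qsphere P !=set0.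
  apply/set0P/eqP => S0; move: mu1; rewrite S0 measure0 => /eqP.
  by rewrite eq_sym onee_eq0.
have iso := @invariant_isotropic _ _ mu P pP.
rewrite eP in muT.
set S := moment mu (qsphere P).
have SE : S = qform (P *m S *m P) e *: invmx P.
  apply: isotropic_moment => // t.
  rewrite (iso muT t (Num.sqrt (qform P t) *: e)); last first.
    by rewrite qformZ sqr_sqrtr ?posdef_ge0// e1 mulr1.
  rewrite (integral_bform_sqr _ cS)// ?pP.1// qformZ sqr_sqrtr ?posdef_ge0//.
  by rewrite mulrC.
exists (qform (P *m S *m P) e); move: SE; set k := qform _ e => SE.
suff kn : k * n%:R = 1.
  split => //; rewrite ltNge; apply/negP => k0.
  by have : 0 <= n%:R :> R := ler0n _ _; nra.
have : \tr (P *m S) = 1.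
  rewrite -[RHS]/(fine 1%E) -[in RHS]mu1.
  exact: (moment_eq1 mu).
by rewrite SE -scalemxAr mulmxV ?posdef_unitmx// linearZ/= mxtrace1.
Qed.

Lemma Mean_qball P A mu k : posdef P -> posdef A ->
  moment mu (qsphere P) = k *: invmx P ->
  Mean (qball P) mu (qball A) = Num.sqrt (k * \tr (A *m invmx P)).
Proof.
move=> pP pA muE; rewrite /Mean boundary_qball//; congr Num.sqrt.
rewrite /Rintegral.
under eq_integral do rewrite (body_norm_qball _ pA).
by rewrite integral_qform ?muE -?scalemxAr ?linearZ//; exact: qsphere_compact.
Qed.

(** Positivity of the trace functional of [invmx P], obtained below from its representation as a
    positive multiple of a second moment. *)
Definition trace_psd P := forall M, (forall x, 0 <= qform M x) ->
  0 <= \tr (M *m invmx P).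

Lemma moment_trace_psd P mu k : posdef P -> 0 < k ->
  moment mu (qsphere P) = k *: invmx P -> trace_psd P.
Proof.
move=> pP k0 muE M M0.
have := moment_ge0 mu (qsphere_compact pP) (fun x _ => M0 x).
by rewrite muE -scalemxAr linearZ/= pmulr_rge0.
Qed.

(** As [B] dominates the identity, the trace of [Y *m Y^T *m invmx P] is at most 0; but it is the
    sum of the values of [qform (invmx P)] at the rows of [Y^T], which must all vanish. *)
Lemma trace_psd_definite P B Y : posdef P -> trace_psd P -> posdef B ->
  \tr (Y *m B *m Y^T *m invmx P) = 0 -> Y = 0.
Proof.
move=> pP tP pB tr0.
have [C C0 hC] := posdef_dominates_qform 1%:M pB.
have : 0 <= \tr ((C *: (Y *m B *m Y^T) - Y *m Y^T) *m invmx P).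
  have YY : Y *m Y^T = Y *m 1%:M *m Y^T by rewrite mulmx1.
  by apply: tP => x; rewrite qformBm qformZm YY -!qform_mul subr_ge0.
rewrite mulmxBl linearB/= -scalemxAl linearZ/= tr0 mulr0 sub0r oppr_ge0.
rewrite -mulmxA mxtrace_mulC -{2}[Y]trmxK mxtrace_conj => le0.
have pI := posdef_inv pP.
have /allP Y0 : all (fun j => qform (invmx P) (row j Y^T) == 0) (index_enum 'I_n).
  have := @psumr_eq0 R _ (index_enum 'I_n) xpredT
    (fun j => qform (invmx P) (row j Y^T)) (fun j _ => posdef_ge0 _ pI).
  move=> <-; rewrite eq_le le0/=.
  by apply: sumr_ge0 => j _; exact: posdef_ge0.
rewrite -[Y]trmxK; apply/trmx_inj; rewrite trmxK trmx0; apply/row_matrixP => j.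
rewrite row0; apply: (posdef_eq0 pI); apply/eqP; exact: Y0 (mem_index_enum j).
Qed.

(* [B - 2 A + A B^-1 A = (B - A) B^-1 (B - A)] is positive semidefinite. *)
Lemma trace_dual_le P A B : posdef P -> trace_psd P -> posdef A -> posdef B ->
  \tr (A *m invmx B *m A *m invmx P) <= \tr (A *m invmx P) ->
  \tr (A *m invmx P) <= \tr (B *m invmx P) ?= iff (A == B).
Proof.
move=> pP tP pA pB le1.
have uB := posdef_unitmx pB; have pIB := posdef_inv pB.
pose X := (B - A) *m invmx B *m (B - A)^T.
have sBA : (B - A)^T = B - A by rewrite linearB/= pA.1 pB.1.
have XE : X = B - A - A + A *m invmx B *m A.
  rewrite /X sBA mulmxBl mulmxV// mulmxBl !mulmxBr !mul1mx mulmxKV//.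
  by rewrite opprB addrCA [RHS]addrC.
have trX : \tr (X *m invmx P) = \tr (B *m invmx P) - \tr (A *m invmx P) -
    \tr (A *m invmx P) + \tr (A *m invmx B *m A *m invmx P).
  by rewrite XE mulmxDl !mulmxBl mxtraceD !raddfB.
have X0 : 0 <= \tr (X *m invmx P).
  by apply: tP => x; rewrite /X -qform_mul; exact: posdef_ge0.
split; first by lra.
apply/eqP/eqP => [AB|->//].
have : B - A = 0 by apply: (trace_psd_definite pP tP pIB); rewrite -/X; lra.
by move=> /eqP; rewrite subr_eq0 eq_sym => /eqP.
Qed.

Lemma isotropic_contact_minimal P A B K : posdef P -> trace_psd P ->
  eprod (qball P) = bform P -> posdef A -> posdef B ->
  @convex_set R 'rV[R]_n K -> qball A `<=` K -> qball B `<=` K ->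
  (exists nu : {finite_measure set (borelRV R n) -> \bar R},
    [/\ nu setT <> 0%E, isotropic (qball P) nu
      & supported_on nu (boundary (qball A) `&` boundary K)]) ->
  \tr (A *m invmx P) <= \tr (B *m invmx P) ?= iff (A == B).
Proof.
move=> pP tP eP pA pB cK AK BK [nu [nu0 [L isoL]]].
rewrite /supported_on boundary_qball// => nuD.
set D := qsphere A `&` boundary K in nuD.
have cD : compact D by exact: contact_compact.
have mD := compact_measurable_rV cD.
rewrite eP in isoL.
have nuE := isotropic_moment cD nuD pP isoL.
have nuDE : nu setT = nu D.
  rewrite -(setUv (D : set (borelRV R n))) measureU//.
  - by transitivity (nu D + 0)%E; [congr (_ + _)%E|rewrite adde0].
  - exact: measurableC.
  - exact: setICr.
(* If [L] were 0 the moment would vanish; its trace against [A], a form equal to 1 on [D], is the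
   total mass of [nu]. *)
have L0 : 0 < L ^+ 2.
  rewrite lt_neqAle sqr_ge0 andbT eq_sym; apply/eqP => L20; apply: nu0.
  have : \tr (A *m moment nu D) = fine (nu D) by apply: moment_eq1 => // x [].
  rewrite nuE L20 scale0r mulmx0 mxtrace0 => /esym D0.
  by rewrite nuDE -[nu D]fineK ?D0//; exact: fin_num_measure.
apply: trace_dual_le => //.
have : 0 <= \tr ((A - A *m invmx B *m A) *m moment nu D).
  apply: moment_ge0 => // x [qx bx]; rewrite qformBm qx subr_ge0.
  exact: (contact_dual_form (K := K)).
by rewrite nuE -scalemxAr linearZ/= pmulr_rge0// mulmxBl linearB/= subr_ge0.
Qed.

Lemma Mean_ge0 E mu F : 0 <= Mean E mu F.
Proof. exact: sqrtr_ge0. Qed.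

Lemma inf_Mean_le E mu K F : ellipsoid F -> F `<=` K ->
  inf_Mean E mu K <= Mean E mu F.
Proof.
move=> eF FK; apply: ge_inf; last by exists F.
by exists 0 => _ [G _ <-]; exact: Mean_ge0.
Qed.

(* Where [H] is positive, adding [s H] shrinks the ball; elsewhere the points
   of the ball are interior to K and a small perturbation stays in K. *)
Lemma qball_perturbation A H K : posdef A -> H^T = H -> closed K ->
  qball A `<=` K ->
  (forall x, qform A x = 1 -> boundary K x -> 0 < qform H x) ->
  exists2 s, 0 < s & posdef (A + s *: H) /\ qball (A + s *: H) `<=` K.
Proof.
move=> pA sH clK AK Hpos.
pose O := [set x | 0 < qform H x] `|` interior K.
have oO : open O.
  apply: openU; last exact: open_interior.
  by apply: (@open_comp _ _ (qform H) [set y | 0 < y]);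
    [move=> ? _; exact: qform_continuous|exact: open_gt].
have AO : qball A `<=` O.
  move=> x Ax; have [xi|nxi] := pselect (interior K x); first by right.
  left; apply: Hpos; last by split => //; apply: subset_closure; exact: AK.
  suff : boundary (qball A) x by rewrite boundary_qball.
  split; first exact: subset_closure.
  by move=> /(interiorS AK).
have [C C0 hC] := posdef_dominates_qform (- H) pA.
(* The points outside [O] with [qform A y <= 2] form a compact set on which [qform A] has a minimum
   above 1; [d] is half of the gap. *)
have [d d0 hd] : exists2 d, 0 < d & forall y, qform A y <= 1 + d -> O y.
  pose Z := [set y | qform A y <= 2] `&` ~` O.
  have cZ : compact Z.
    have pA2 : posdef (2^-1 *: A).
      split; first by rewrite linearZ/= pA.1.
      by move=> x x0; rewrite qformZm mulr_gt0 ?invr_gt0 ?pA.2.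
    apply: (subclosed_compact _ (qball_compact pA2)).
      apply: closedI; last exact: open_closedC.
      by apply: (@preimage_closed _ _ (qform A) [set y | y <= 2]);
        [move=> ? _; exact: qform_continuous|exact: closed_le].
    by move=> y [/= y2 _]; rewrite /qball/= qformZm; lra.
  have [[z Zz]|Z0] := pselect (Z !=set0); last first.
    exists 1 => // y y2; apply: contrapT => nOy; apply: Z0.
    by exists y; split => //=; lra.
  have [w] := EVT_min_rV (ex_intro _ z Zz) cZ
    (continuous_subspaceT (@qform_continuous _ _ A)).
  rewrite inE => -[/= w2 nOw] minw.
  have w1 : 1 < qform A w.
    by rewrite ltNge; apply/negP => w1; apply: nOw; exact: AO.
  exists ((qform A w - 1) / 2); first by lra.
  move=> y yd; apply: contrapT => nOy.
  have : qform A w <= qform A y by apply: minw; rewrite inE; split => //=; lra.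
  lra.
(* Chosen so that [1 - s * C] is the inverse of [1 + d]: the perturbed ball then lies in the region
   [qform A y <= 1 + d]. *)
pose s := d / ((1 + d) * C).
have dC : 0 < (1 + d) * C by rewrite mulr_gt0//; lra.
have s0 : 0 < s by rewrite divr_gt0.
have sC : s * C * (1 + d) = d by rewrite -mulrA [C * _]mulrC mulfVK// gt_eqF.
have qs x : qform (A + s *: H) x = qform A x + s * qform H x.
  by rewrite qformDm qformZm.
clearbody s; exists s => //.
have sC1 : s * C < 1 by nra.
have hs x : (1 - s * C) * qform A x <= qform (A + s *: H) x.
  have := hC x; rewrite qs -scaleN1r qformZm => h.
  have : s * (-1 * qform H x) <= s * (C * qform A x) by rewrite ler_pM2l.
  lra.
split.
  split; first by rewrite linearD/= linearZ/= pA.1 sH.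
  move=> x x0; apply: lt_le_trans (hs x).
  by rewrite mulr_gt0 ?pA.2// subr_gt0.
move=> y /= ys; have [h0|h0] := ltP 0 (qform H y).
  apply: AK; rewrite /qball/=; move: ys; rewrite /qball/= qs.
  have : 0 < s * qform H y by rewrite mulr_gt0.
  lra.
have [|/interior_subset//] : O y; last by rewrite /= ltNge h0.
apply: hd; have := le_trans (hs y) ys.
have -> : 1 - s * C = (1 + d)^-1.
  apply: (mulIf (x := 1 + d)); first by rewrite gt_eqF//; lra.
  by rewrite mulVf ?gt_eqF//; lra.
by rewrite mulrC ler_pdivrMr ?mul1r//; lra.
Qed.

Lemma rank1_continuous : continuous (fun x : 'rV[R]_n => mxvec (x^T *m x)).
Proof.
apply: continuous_mx => i k; rewrite (ord1 i).
case/mxvec_indexP: k => a b.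
rewrite (_ : (fun x => _) = fun x : 'rV[R]_n => x 0 a * x 0 b).
  exact: coord_mul_continuous.
by apply/funext => x; rewrite mxvecE mxE big_ord1 mxE.
Qed.

(* Either [P^-1] is a conic combination of the contact matrices [x^T x], which
   is the isotropic measure, or a separating symmetric matrix [H] gives a
   direction [A + s H] that decreases the trace while staying inside K. *)
Lemma minimal_isotropic_contact P A K : posdef P ->
  eprod (qball P) = bform P -> posdef A -> closed K -> qball A `<=` K ->
  0 < \tr (A *m invmx P) ->
  (forall B, posdef B -> qball B `<=` K ->
    \tr (A *m invmx P) <= \tr (B *m invmx P)) ->
  exists nu : {finite_measure set (borelRV R n) -> \bar R},
    [/\ nu setT <> 0%E, isotropic (qball P) nu
      & supported_on nu (boundary (qball A) `&` boundary K)].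
Proof.
move=> pP eP pA clK AK; set l := \tr (A *m invmx P) => l0 Amin.
set D := boundary (qball A) `&` boundary K.
have DE : D = qsphere A `&` boundary K by rewrite /D boundary_qball.
have cD : compact D by rewrite DE; exact: contact_compact.
have sPI : (invmx P)^T = invmx P by rewrite trmx_inv pP.1.
pose S := (fun x : 'rV[R]_n => mxvec (x^T *m x)) @` D.
have cS : compact S.
  apply: continuous_compact => //; apply: continuous_subspaceT.
  exact: rank1_continuous.
(* The factor [l^-1] puts [v] on the hyperplane where [dotr (mxvec A)] is 1, which contains [S]. *)
pose v := mxvec (l^-1 *: invmx P).
have vE M : dotr (mxvec M) v = l^-1 * \tr (M *m invmx P).
  by rewrite dotr_mxvec linearZ/= sPI -scalemxAr linearZ.
have [||[c [X [c01 SX vc]]]|[h [hS hv]]] := @conic_separation _ _ S (mxvec A) v cS.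
- by move=> _ [x + <-]; rewrite DE dotr_mxvec_qform => -[].
- by rewrite vE mulVf// gt_eqF.
- have /choice[y yE] i : exists x, D x /\ mxvec (x^T *m x) = X i.
    by have [x Dx xX] := SX i; exists x.
  have c0 i : 0 <= c i by have /andP[] := c01 i.
  have [nu [nuE nuI]] := @discrete_measure _ (borelRV R n) R _ c y c0.
  have Ivc N : \sum_i c i * qform N (y i) = l^-1 * \tr (N *m invmx P).
    rewrite -vE vc; elim/big_ind2 : _ => [|a1 b1 a2 b2 -> ->|i _].
    + by rewrite -(scale0r (mxvec A)) dotrZr mul0r.
    + by rewrite dotrDr.
    + by rewrite dotrZr -(yE i).2 dotr_mxvec_qform.
  exists nu; split.
  + rewrite nuE (_ : (\sum_i _)%E = 1%E); first by apply/eqP; rewrite onee_eq0.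
    have := Ivc A; rewrite -/l mulVf ?gt_eqF// => <-.
    rewrite -sumEFin; apply: eq_bigr => i _; rewrite diracT mule1.
    by have := (yE i).1; rewrite DE => -[-> _]; rewrite mulr1.
  + exists (Num.sqrt l^-1) => t; rewrite eP sqr_sqrtr ?invr_ge0 1?ltW//.
    rewrite nuI; last by move=> x; rewrite lee_fin sqr_ge0.
      (* The trace form makes [Ivc] applicable to the rank-one matrix of [bform P x t ^+ 2]. *)
      rewrite (_ : bform P t t = \tr (P *m t^T *m t *m P *m invmx P)); last first.
        by rewrite mulmxK ?posdef_unitmx// -mulmxA -bform_trace.
      rewrite -Ivc -sumEFin; apply: eq_bigr => i _.
      by rewrite (bform_sqr _ _ pP.1).
    apply/measurable_EFinP; apply: continuous_measurable_rV.
    exact: bform_sqr_continuous.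
  + rewrite /supported_on nuE big1// => i _.
    by rewrite diracE memNset ?mule0//; have [yD _] := yE i; exact.
(* The separating matrix [M] may fail to be symmetric; symmetrizing doubles both its quadratic form
   and its trace against [invmx P], so the signs persist. *)
- exfalso; pose M := vec_mx h; pose H := M + M^T.
  have sH : H^T = H by rewrite linearD/= trmxK addrC.
  have hE : h = mxvec M by rewrite vec_mxK.
  have [x qx bx|s s0 [pAs AsK]] := qball_perturbation pA sH clK AK.
    have : 0 < dotr h (mxvec (x^T *m x)) by apply: hS; exists x => //; rewrite DE.
    by rewrite hE dotr_mxvec_qform qformDm qform_trmx => ?; rewrite addr_gt0.
  have := Amin _ pAs AsK; apply/negP; rewrite -ltNge.
  rewrite mulmxDl linearD/= gtrDl -scalemxAl linearZ/= pmulr_rlt0//.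
  have : \tr (M *m invmx P) < 0.
    by move: hv; rewrite hE vE pmulr_rlt0// invr_gt0.
  have trM : \tr (M^T *m invmx P) = \tr (M *m invmx P).
    by rewrite -mxtrace_tr trmx_mul trmxK sPI mxtrace_mulC.
  by rewrite mulmxDl linearD/= trM; lra.
Qed.

End Main.

Theorem proposition1p1 (R : realType) (n : nat) (K E F : set 'rV[R]_n)
    (mu : probability (borelRV R n) R) :
  body K -> ellipsoid E -> ellipsoid F -> F `<=` K ->
  invariant_probability E mu ->
  is_u E mu K F <->
  exists nu : {finite_measure set (borelRV R n) -> \bar R},
    [/\ nu setT <> 0%E, isotropic E nu
      & supported_on nu (boundary F `&` boundary K)].
Proof.
move=> [cpK cK _ _] /ellipsoidP[P [pP -> eP]] eF.
have [A [pA FA _]] := ellipsoidP eF; rewrite FA => AK muP.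
have clK : closed K := compact_closed (@norm_hausdorff _ _) cpK.
have [k [k0 kn muE]] := invariant_moment pP eP muP.
have tP := moment_trace_psd pP k0 muE.
have MeanE B (pB : posdef B) := Mean_qball pP pB muE.
have tr0 B : posdef B -> 0 <= \tr (B *m invmx P).
  by move=> pB; apply: tP => x; exact: posdef_ge0.
have leMean B G (pB : posdef B) (pG : posdef G) :
    (Mean (qball P) mu (qball B) <= Mean (qball P) mu (qball G)) =
    (\tr (B *m invmx P) <= \tr (G *m invmx P)).
  rewrite !MeanE// ler_psqrt ?nnegrE ?(mulr_ge0 (ltW k0)) ?tr0//.
  by rewrite ler_pM2l.
split=> [[[_ _ Finf] _]|nuP].
  apply: minimal_isotropic_contact => //; last first.
    move=> B pB BK; have := inf_Mean_le (qball P) mu (qball_ellipsoid pB) BK.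
    by rewrite -Finf leMean.
  (* Strict positivity of the trace: dominating [P] by [C *: A] gives
     [n%:R <= C * \tr (A *m invmx P)], and [k * n%:R = 1] makes [n] positive. *)
  have [C C0 hC] := posdef_dominates_qform P pA.
  have : 0 <= \tr ((C *: A - P) *m invmx P).
    by apply: tP => x; rewrite qformBm qformZm subr_ge0.
  rewrite mulmxBl linearB/= mulmxV ?posdef_unitmx// mxtrace1 -scalemxAl linearZ/=.
  rewrite subr_ge0 => nC; rewrite -(pmulr_rgt0 _ C0); apply: lt_le_trans nC.
  by rewrite -(pmulr_rgt0 _ k0) kn.
have min B : posdef B -> qball B `<=` K ->
    \tr (A *m invmx P) <= \tr (B *m invmx P) ?= iff (A == B).
  by move=> pB BK; exact: (isotropic_contact_minimal (K := K)).
have Finf : Mean (qball P) mu (qball A) = inf_Mean (qball P) mu K.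
  apply/eqP; rewrite eq_le; apply/andP; split; last first.
    by apply: inf_Mean_le => //; exact: qball_ellipsoid.
  apply: lb_le_inf.
    exists (Mean (qball P) mu (qball A)); exists (qball A) => //.
    by split => //; exact: qball_ellipsoid.
  move=> _ [G [/ellipsoidP[B [pB -> _]] BK] <-].
  by rewrite leMean// (min B pB BK).
split; first by split => //; exact: qball_ellipsoid.
move=> G [/ellipsoidP[B [pB -> _]] BK]; rewrite -Finf => BA.
have [ABle ABeq] := min B pB BK.
(* Another minimizer has the same trace, and the equality case of [min] identifies the matrices. *)
have BAle : \tr (B *m invmx P) <= \tr (A *m invmx P).
  by rewrite -(leMean B A pB pA) BA.
by have /eqP -> : A == B by rewrite -ABeq eq_le ABle BAle.
Qed.
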